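(* Let $n=2$, $m_1,m_2\ge 2$ and $m_*=\min\{m_1,m_2\}$. For any $k\in\{1,\dots,m_*\}$ and $t\in\{1,\dots,2(m_*-k+1)\}$, $$\Pr\left[\text{the clockwork best-response dynamic on } G_{2,\mathbf{m}} \text{ converges to a } 2k\text{-cycle at time } t\right]=\frac{1}{m_{s_{\texttt{c}}(t+2k-1)}}\prod_{i=1}^{t+2k-2}\left(1-\frac{1}{m_{s_{\texttt{c}}(i)}}\left\lfloor\frac{i}{2}\right\rfloor\right).$$
   Context: A random 2-player game $G_{2,\mathbf{m}}$: player $i\in\{1,2\}$ has actions $[m_i]=\{1,\dots,m_i\}$; $\mathcal{M}=[m_1]\times[m_2]$. Payoffs $U_i(\mathbf{a})$, $i\in\{1,2\}$, $\mathbf{a}\in\mathcal{M}$, are drawn independently from a fixed atomless distribution on $\mathbb{R}$; the best response $B_i(a_{-i})=\arg\max_{x\in[m_i]}U_i(x,a_{-i})$ is a.s. unique. The clockwork sequence is $s_{\texttt{c}}(t)=1+((t-1)\bmod 2)$ (player 1 at odd times, player 2 at even times). The clockwork best-response dynamic: $\mathbf{A}^0$ uniform on $\mathcal{M}$ independent of payoffs; for $t\ge 1$ with $i=s_{\texttt{c}}(t)$, $A^t_{-i}=A^{t-1}_{-i}$ and $A^t_i=B_i(A^{t-1}_{-i})$. The dynamic converges to a $2k$-cycle at time $t$ if $t=\inf\{\tau\ge 1:\mathbf{A}^\tau=\mathbf{A}^{\tau+2k}\text{ and }\mathbf{A}^\tau\ne\mathbf{A}^{\tau+2k'}\text{ for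 all }k'\in\{1,\dots,k-1\}\}$ (so from time $t$ on the $2k$ profiles $\mathbf{A}^t,\dots,\mathbf{A}^{t+2k-1}$ repeat forever); $k=1$ corresponds to convergence to a pure Nash equilibrium at time $t$. *)

(* Defs.v *)
From HB Require Import structures.
From mathcomp Require Import all_boot all_order all_algebra.
From mathcomp Require Import all_classical all_reals all_analysis.
Set Implicit Arguments. Unset Strict Implicit. Unset Printing Implicit Defensive.
Import Order.TTheory GRing.Theory Num.Theory.
Local Open Scope ring_scope.

Section Game.
Variables (R : realType) (m1 m2 : nat).

Definition profile := ('I_m1 * 'I_m2)%type.

(* Payoff indices: (player, profile); player 0 is "player 1", player 1 is "player 2". *)
Definition pindex := ('I_2 * profile)%type.

(* Clockwork sequence s_c(t) = 1 + ((t-1) mod 2): player 1 at odd t. *)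
Definition m_sc (t : nat) : nat := if odd t then m1 else m2.

Variable U : pindex -> R.   (* a realization of the payoffs *)

(* Best responses (argmax; a.s. unique, so the tie-breaking default is irrelevant). *)
Definition BR1 (x0 : 'I_m1) (a2 : 'I_m2) : 'I_m1 :=
  Order.arg_max x0 xpredT (fun x : 'I_m1 => U (ord0, (x, a2))).
Definition BR2 (y0 : 'I_m2) (a1 : 'I_m1) : 'I_m2 :=
  Order.arg_max y0 xpredT (fun y : 'I_m2 => U (ord_max, (a1, y))).

Definition cw_step (t : nat) (a : profile) : profile :=
  if odd t then (BR1 a.1 a.2, a.2) else (a.1, BR2 a.2 a.1).

Fixpoint cw_dyn (a0 : profile) (t : nat) : profile :=
  match t with
  | 0 => a0
  | t'.+1 => cw_step t'.+1 (cw_dyn a0 t')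
  end.

Definition cycle_cond (a0 : profile) (k tau : nat) : Prop :=
  cw_dyn a0 tau = cw_dyn a0 (tau + 2 * k) /\
  forall k', (1 <= k')%N -> (k' < k)%N -> cw_dyn a0 tau <> cw_dyn a0 (tau + 2 * k').

Definition converges_at (a0 : profile) (k t : nat) : Prop :=
  (1 <= t)%N /\ cycle_cond a0 k t /\
  forall tau, (1 <= tau)%N -> (tau < t)%N -> ~ cycle_cond a0 k tau.

End Game.

(* Main.v *)
(** Let [v 0] be the initial action of player 2 and [v (n+1)] the best response
    to [v n]; then [A^t] consists of [v t] and [v (t-1)], and the dynamic
    converges to a [2k]-cycle at time [t] iff [v 0, ..., v (t+2k-2)] are distinct
    (actions of different players count as distinct) and [v (t+2k-1) = v (t-1)].
    Permuting the payoffs inside the rows of the game preserves their joint law,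
    and ties have probability zero, so the pair of best-response maps is uniform
    and independent of [A^0].  It remains to count such pairs: as long as
    [v 0, ..., v n] are distinct, the response to [v n] has not been used yet, so
    redirecting it shows that [v (n+1)] is uniform given the past. *)

Require Import Defs.
From HB Require Import structures.
From mathcomp Require Import all_boot all_order all_algebra.
From mathcomp Require Import all_classical all_reals all_analysis.
From mathcomp Require Import perm zify ring.
Import Order.TTheory GRing.Theory Num.Theory.
Import numFieldNormedType.Exports.
Set Implicit Arguments. Unset Strict Implicit. Unset Printing Implicit Defensive.
Local Open Scope ring_scope.
Local Open Scope classical_set_scope.

(** * First return of an iterated map *)

Section FirstReturn.
Local Open Scope nat_scope.
Variables (V : eqType) (F : V -> V) (x : V) (s k : nat).
Let v i := iter i F x.

(** Counterpart of [cycle_cond] with time shifted by one: index [r] here stands for time [r.+1] of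
    the dynamic. *)
Definition return_cond (r : nat) : Prop :=
  v r = v (r + 2 * k) /\ forall l, 1 <= l -> l < k -> v r <> v (r + 2 * l).

Lemma iter_shift i j n : v i = v j -> v (i + n) = v (j + n).
Proof. by rewrite /v ![_ + n]addnC !iterD => ->. Qed.

Lemma iter_period i p n : v i = v (i + p) -> v i = v (i + p * n).
Proof.
move=> e; elim: n => [|n IH]; first by rewrite muln0 addn0.
by rewrite mulnS addnA -(iter_shift (p * n) e).
Qed.

Lemma uniq_trajectP n :
  reflect (forall i j, i < j < n -> v i <> v j) (uniq (traject F x n)).
Proof.
apply: (iffP idP) => [u i j /andP[ij jn] e|h].
  have ltin := ltn_trans ij jn.
  have /eqP := e; rewrite /v -(nth_traject F ltin x) -(nth_traject F jn x).
  by rewrite nth_uniq ?size_traject // ltn_eqF.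
apply/negPn/negP => /(uniqPn x)[i [j [ij]]]; rewrite size_traject => jn.
by rewrite !nth_traject ?(ltn_trans ij jn) //; apply: h; rewrite ij jn.
Qed.

Hypothesis parity : forall i j, v i = v j -> odd i = odd j.
Hypothesis k_gt0 : 0 < k.

(** A repetition passes on to all later indices, and from [s] on the orbit has period [2 * k]. Hence
    a repetition starting before [s], or one of a shorter even lag, contradicts the choice of [s] or
    of [k]; odd lags are excluded by [parity]. *)
Lemma first_returnP :
  return_cond s /\ (forall r, r < s -> ~ return_cond r) <->
  uniq (traject F x (s + 2 * k)) /\ v (s + 2 * k) = v s.
Proof.
split=> [[[vs min_k] first]|[/uniq_trajectP u e]]; last first.
  split; first by split=> // l l1 lk; apply: u; lia.
  by move=> r rs [+ _]; apply: u; lia.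
(* A short repetition at [i] is shifted to [s + 2 * k * i], which is past [i], and then brought back
   to [s] by periodicity. *)
have short i l : 1 <= l -> l < k -> v i <> v (i + 2 * l).
  move=> l1 lk e; apply: (min_k l) => //.
  have le : i <= s + 2 * k * i by nia.
  have := iter_shift (s + 2 * k * i - i) e.
  rewrite subnKC // addnAC subnKC // -(iter_period i vs) => ->.
  by rewrite -(iter_shift (2 * l) (iter_period i vs)).
split=> //; apply/uniq_trajectP => i j ij e.
have := parity e => oij.
have [l jE] : exists l, j = i + 2 * l by exists (j - i)./2; lia.
have [si|si] := leqP s i; first by apply: (short i l); rewrite -?jE //; lia.
(* Here [i < s]. Its own period [2 * l] moves [i] to [i + 2 * l * s], which is at least [s], where
   the lag [2 * k] is a period; so [i] would be an earlier return. *)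
apply: (first i) => //; split=> [|l' ? ?]; last exact: short.
rewrite jE in e.
have e1 := iter_period s e.
rewrite e1 -(iter_shift (2 * k) (esym e1)).
have le : s <= i + 2 * l * s by nia.
have := iter_shift (i + 2 * l * s - s) vs.
by rewrite addnAC subnKC.
Qed.
End FirstReturn.

(** * Counting pairs of best-response maps by redirecting one response *)

Section Counting.
Local Open Scope nat_scope.
Variables m1 m2 : nat.

Definition action := ('I_m1 + 'I_m2)%type.
Definition brpair := ({ffun 'I_m2 -> 'I_m1} * {ffun 'I_m1 -> 'I_m2})%type.

Definition respond (h : brpair) (z : action) : action :=
  match z with inl x => inr (h.2 x) | inr y => inl (h.1 y) end.

Definition is_first (z : action) : bool := if z is inl _ then true else false.

(** The last branch is a dummy value: a response always belongs to the other player. *)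
Definition reset (h : brpair) (z w : action) : brpair :=
  match z, w with
  | inr y, inl x => ([ffun y' => if y' == y then x else h.1 y'], h.2)
  | inl x, inr y => (h.1, [ffun x' => if x' == x then y else h.2 x'])
  | _, _ => h
  end.

Lemma is_first_respond h z : is_first (respond h z) = ~~ is_first z.
Proof. by case: z. Qed.

Lemma is_first_iter h z n : is_first (iter n (respond h) z) = odd n (+) is_first z.
Proof. by elim: n => //= n IH; rewrite is_first_respond IH addNb. Qed.

Lemma respond_reset h z w u : is_first w = ~~ is_first z ->
  respond (reset h z w) u = if u == z then w else respond h u.
Proof.
by case: z w u => [x|y] [x'|y'] [x''|y''] //= _;
  rewrite ?ffunE ?(inj_eq (@inl_inj _ _)) ?(inj_eq (@inr_inj _ _)) //; case: ifP.
Qed.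

Lemma respond_inj h h' : respond h =1 respond h' -> h = h'.
Proof.
case: h h' => [f g] [f' g'] e; congr pair; apply/ffunP.
  by move=> y; case: (e (inr y)).
by move=> x; case: (e (inl x)).
Qed.

(* If the first [n] steps do not leave from [z], they never query the response to [z]. *)
Lemma iter_reset h z w v0 n : is_first w = ~~ is_first z ->
  z \notin traject (respond h) v0 n ->
  forall i, i <= n -> iter i (respond (reset h z w)) v0 = iter i (respond h) v0.
Proof.
move=> wz zn; elim=> // i IH ltin /=; rewrite IH ?(ltnW ltin) // respond_reset //.
case: eqP => // e; case/negP: zn; apply/trajectP; by exists i.
Qed.

Variable y0 : 'I_m2.
Definition visit (h : brpair) i : action := iter i (respond h) (inr y0).

Lemma visitS h i : visit h i.+1 = respond h (visit h i).
Proof. by []. Qed.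

Definition fresh n : pred brpair :=
  fun h => uniq (traject (respond h) (inr y0) n.+1).
Definition back n j : pred brpair :=
  fun h => fresh n h && (visit h n.+1 == visit h j).

Lemma is_first_visit h i : is_first (visit h i) = odd i.
Proof. by rewrite is_first_iter /= addbF. Qed.

Lemma fresh_notin n h : fresh n h -> visit h n \notin traject (respond h) (inr y0) n.
Proof. by rewrite /fresh trajectSr rcons_uniq => /andP[]. Qed.

Lemma visit_reset n h w i : fresh n h -> is_first w = ~~ odd n -> i <= n ->
  visit (reset h (visit h n) w) i = visit h i.
Proof. by move=> /fresh_notin hn wn; apply: iter_reset => //; rewrite wn is_first_visit. Qed.

Lemma visit_resetS n h w : fresh n h -> is_first w = ~~ odd n ->
  visit (reset h (visit h n) w) n.+1 = w.
Proof.
move=> hn wn; rewrite visitS visit_reset // respond_reset ?eqxx //.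
by rewrite wn is_first_visit.
Qed.

Lemma fresh_reset n h w : fresh n h -> is_first w = ~~ odd n ->
  fresh n (reset h (visit h n) w).
Proof.
move=> hn wn; apply/uniq_trajectP => i j ij.
rewrite -[iter i _ _]/(visit _ i) -[iter j _ _]/(visit _ j) !visit_reset //; try lia.
by move/uniq_trajectP: hn; apply.
Qed.

Lemma reset_reset h z w w' : is_first w = ~~ is_first z -> is_first w' = ~~ is_first z ->
  reset (reset h z w) z w' = reset h z w'.
Proof.
by case: z w w' => [x|y] [x1|y1] [x2|y2] //= _ _;
  congr pair; apply/ffunP => u; rewrite !ffunE; case: eqP.
Qed.

Lemma reset_id h z : reset h z (respond h z) = h.
Proof.
apply: respond_inj => u; rewrite respond_reset ?is_first_respond //.
by case: eqP => [->|].
Qed.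

Lemma card_side b : #|[pred w | is_first w == b]| = if b then m1 else m2.
Proof.
case: b.
  rewrite -[RHS]card_ord -(fintype.card_image (@inl_inj 'I_m1 'I_m2)).
  apply: eq_card => -[x|y]; rewrite !inE /=.
    by rewrite (fintype.mem_image (@inl_inj _ _)).
  by apply/esym/negbTE/fintype.imageP => -[].
rewrite -[RHS]card_ord -(fintype.card_image (@inr_inj 'I_m1 'I_m2)).
apply: eq_card => -[x|y]; rewrite !inE /=.
  by apply/esym/negbTE/fintype.imageP => -[].
by rewrite (fintype.mem_image (@inr_inj _ _)).
Qed.

(** Redirecting the response to [visit h n] towards [visit h j] maps [fresh n] onto [back n j]. Each
    fibre is obtained by letting this one response vary freely over the actions of the player who
    moves at time [n.+1]. *)
Lemma card_back n j : j <= n -> odd (n - j) -> #|back n j| * m_sc m1 m2 n.+1 = #|fresh n|.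
Proof.
move=> jn oj.
(* Since [n - j] is odd, [visit h j] is an admissible response to [visit h n]. *)
have sidej h : is_first (visit h j) = ~~ odd n by rewrite is_first_visit; lia.
pose redirect h := reset h (visit h n) (visit h j).
rewrite -[RHS]sum1_card (partition_big redirect (back n j)); last first.
  move=> h hn; rewrite /back fresh_reset // visit_resetS //=.
  by rewrite visit_reset // eqxx.
rewrite -sum_nat_const; apply: eq_bigr => h /andP[hn /eqP hj].
rewrite sum1_card -[m_sc m1 m2 _]/(if odd n.+1 then m1 else m2) -card_side.
(* The fibre over [h] is parametrised by the new response [w], which can be read off as visit
   [n.+1]. *)
rewrite -(@fintype.card_in_image _ _ (reset h (visit h n))); last first.
  move=> w w'; rewrite !inE => /eqP ow /eqP ow' e.
  by rewrite -(visit_resetS hn ow) e visit_resetS.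
apply: eq_card => h'; rewrite [RHS]unfold_in; apply/fintype.imageP/idP => [[w]|].
  rewrite inE => /eqP ow ->.
  have -> /= : reset h (visit h n) w \in fresh n by exact: fresh_reset.
  rewrite /redirect !visit_reset // reset_reset ?sidej ?is_first_visit //.
  by rewrite -hj visitS reset_id.
move=> /andP[h'n /eqP <-].
(* Restoring the original response of [h'] undoes the redirection. *)
exists (visit h' n.+1); first by rewrite inE is_first_visit.
by rewrite /redirect visit_reset // reset_reset ?sidej ?is_first_visit // visitS reset_id.
Qed.

Lemma card_back_even n j : j <= n -> ~~ odd (n - j) -> #|back n j| = 0.
Proof.
move=> jn oj; apply: eq_card0 => h; rewrite unfold_in.
apply/negbTE/negP => /andP[_ /eqP e].
have := congr1 is_first e; rewrite !is_first_visit /=; lia.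
Qed.

(** After distinct visits up to [n], the next one is either new or equal to exactly one earlier
    visit. *)
Lemma fresh_split n : #|fresh n| = #|fresh n.+1| + \sum_(j < n.+1) #|back n j|.
Proof.
rewrite -!sum1_card.
rewrite [X in _ = X + _]big_mkcond [X in X = _]big_mkcond /=.
under [X in _ = _ + X]eq_bigr do rewrite -sum1_card big_mkcond /=.
rewrite exchange_big -big_split /=; apply: eq_bigr => h _.
have memE (p : pred brpair) : (h \in p) = p h by [].
under eq_bigr do rewrite memE /back.
rewrite !memE.
have -> : fresh n.+1 h =
    fresh n h && (visit h n.+1 \notin traject (respond h) (inr y0) n.+1).
  by rewrite /fresh trajectSr rcons_uniq andbC.
have [hn|] /= := boolP (fresh n h); last by rewrite big1.
(* The number of matching [j] is a multiplicity in a duplicate-free list, hence a membership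
   indicator. *)
have -> : \sum_(j < n.+1) (if visit h n.+1 == visit h j then 1 else 0) =
    count_mem (visit h n.+1) (traject (respond h) (inr y0) n.+1).
  rewrite -sum1_count [RHS]big_mkcond (big_nth (inr y0)) size_traject big_mkord.
  by apply: eq_bigr => j _; rewrite nth_traject //= eq_sym.
by rewrite count_uniq_mem //; case: (_ \in _).
Qed.
End Counting.

(** * The counts as a product of conditional probabilities *)

Section CountingRatio.
Variables (R : realFieldType) (m1 m2 : nat) (y0 : 'I_m2).
Hypotheses (m1_gt0 : (0 < m1)%N) (m2_gt0 : (0 < m2)%N).

Let m_neq0 n : (m_sc m1 m2 n)%:R != 0 :> R.
Proof. by rewrite /m_sc pnatr_eq0; case: odd; rewrite -lt0n. Qed.

Lemma card_back_ratio n j : (j <= n)%N -> odd (n - j) ->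
  #|back (m1 := m1) y0 n j|%:R = #|fresh (m1 := m1) y0 n|%:R / (m_sc m1 m2 n.+1)%:R :> R.
Proof.
by move=> jn oj; rewrite -(card_back _ _ jn oj) natrM mulfK.
Qed.

(** Only the indices [j] with [n - j] odd can be hit; there are [n.+1./2] of them, each taking the
    same share of [fresh n]. *)
Lemma card_freshS n : #|fresh (m1 := m1) y0 n.+1|%:R =
  #|fresh (m1 := m1) y0 n|%:R * (1 - (n.+1./2)%:R / (m_sc m1 m2 n.+1)%:R) :> R.
Proof.
set x := #|fresh y0 n|%:R; set m := (m_sc _ _ _)%:R : R.
have -> : #|fresh (m1 := m1) y0 n.+1|%:R =
    x - \sum_(j < n.+1) #|back (m1 := m1) y0 n j|%:R :> R.
  by rewrite /x (fresh_split m1 y0 n) natrD natr_sum addrK.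
have -> : \sum_(j < n.+1) #|back (m1 := m1) y0 n j|%:R =
    \sum_(j < n.+1) (odd (n - j))%:R * (x / m) :> R.
  apply: eq_bigr => j _; have jn : (j <= n)%N by rewrite -ltnS.
  have [oj|oj] := boolP (odd (n - j)); first by rewrite card_back_ratio ?mul1r.
  by rewrite card_back_even // mul0r.
have -> : \sum_(j < n.+1) (odd (n - j))%:R * (x / m) = (n.+1./2)%:R * (x / m).
  rewrite -mulr_suml -natr_sum; congr (_%:R * _).
  (* Reversing the order turns [odd (n - j)] into [odd j], so that the bound can be generalised to
     [l] for an induction. *)
  rewrite (reindex_inj rev_ord_inj) /=.
  under eq_bigr => j _ do rewrite subSS subKn ?leq_ord //.
  rewrite -[uphalf n]/(n.+1./2); elim: (n.+1) => [|l IH]; first by rewrite big_ord0.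
  by rewrite big_ord_recr /= IH; lia.
by ring.
Qed.

Lemma card_fresh n : #|fresh (m1 := m1) y0 n|%:R =
  #|{: brpair m1 m2}|%:R * \prod_(1 <= i < n.+1) (1 - (i./2)%:R / (m_sc m1 m2 i)%:R) :> R.
Proof.
elim: n => [|n IH]; last by rewrite big_nat_recr //= card_freshS IH mulrA.
by rewrite big_geq // mulr1; congr (_%:R); apply: eq_card.
Qed.

End CountingRatio.

(** * The dynamic as an orbit of the response map *)

Section CycleEvent.
Variables (R : realType) (m1 m2 : nat) (u : pindex m1 m2 -> R) (h : brpair m1 m2).
Hypotheses (BR1E : forall x y, BR1 u x y = h.1 y) (BR2E : forall y x, BR2 u y x = h.2 x).
Variable a : profile m1 m2.

Lemma cw_dynS n :
  cw_dyn u a n.+1 = if odd n then ((cw_dyn u a n).1, h.2 (cw_dyn u a n).1)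
                    else (h.1 (cw_dyn u a n).2, (cw_dyn u a n).2).
Proof. by rewrite /= /cw_step /= BR1E BR2E; case: odd. Qed.

(** The correspondence starts at time one, because the initial action of player 1 is overwritten
    before anyone responds to it. *)
Lemma visit_cw_dyn n : visit a.2 h n.+1 =
    (if odd n then inr (cw_dyn u a n.+1).2 else inl (cw_dyn u a n.+1).1) /\
  visit a.2 h n = (if odd n then inl (cw_dyn u a n.+1).1 else inr (cw_dyn u a n.+1).2).
Proof.
elim: n => [|n [IH _]]; first by rewrite /= /cw_step /= BR1E.
by rewrite cw_dynS visitS IH [odd n.+1]/=; case: odd.
Qed.

(** The retained action determines the new one, so one visit determines the whole profile once the
    parity tells whose action it is. *)
Lemma cw_dyn_eqP i j : odd i = odd j ->
  (cw_dyn u a i.+1 = cw_dyn u a j.+1) <-> visit a.2 h i = visit a.2 h j.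
Proof.
move=> ij; have [i1 i2] := visit_cw_dyn i; have [j1 j2] := visit_cw_dyn j.
split=> [e|e]; first by rewrite i2 j2 ij e.
have e' : visit a.2 h i.+1 = visit a.2 h j.+1 by rewrite !visitS e.
move: e e'; rewrite i1 j1 i2 j2 -ij.
case: (cw_dyn u a i.+1) => x y; case: (cw_dyn u a j.+1) => x' y' /=.
by case: odd => -[->] [->].
Qed.

Lemma converges_at_back k t : (1 <= k)%N -> (1 <= t)%N ->
  converges_at u a k t <-> back a.2 (t + 2 * k - 2) (t - 1) h.
Proof.
move=> k1; case: t => // s _.
have cE r : cycle_cond u a k r.+1 <-> return_cond (respond h) (inr a.2) k r.
  rewrite /cycle_cond /return_cond !addSn cw_dyn_eqP; last by rewrite oddD oddM addbF.
  by split=> -[e hk]; split=> // l l1 lk; have := hk l l1 lk;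
    rewrite !addSn cw_dyn_eqP // oddD oddM addbF.
have par i j : visit a.2 h i = visit a.2 h j -> odd i = odd j.
  by move=> e; rewrite -(is_first_visit a.2 h i) e is_first_visit.
rewrite /back /fresh.
(* With [t = s.+1], the distinct visits are those of index below [s + 2 * k], and the next one
   closes the cycle at index [s]. *)
have -> : (s.+1 + 2 * k - 2).+1 = (s + 2 * k)%N by lia.
rewrite subn1 /=.
have [f1 f2] := first_returnP s par k1.
split=> [[_ [c hc]]|/andP[uq /eqP e]].
  have [] := f1 _; last by move=> -> e; apply/eqP.
  by split=> [|r rs]; [exact/cE | move/cE; exact: hc].
have [|c hc] := f2 _; first by [].
split=> //; split; first exact/cE.
by move=> [//|r] _ rs /cE; exact: hc.
Qed.
End CycleEvent.

(** * Joint laws of finite families of random variables *)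

Lemma pushforward_measure_ex (d d' : measure_display) (T1 : measurableType d)
    (T2 : measurableType d') (R : realType) (m : {measure set T1 -> \bar R})
    (f : T1 -> T2) : measurable_fun setT f ->
  exists m' : {measure set T2 -> \bar R}, forall A, m' A = m (f @^-1` A).
Proof. by move=> mf; unshelve eexists [the measure _ _ of pushforward m f]. Qed.

Section JointLaw.
Variables (R : realType) (J : finType).

Definition box (B : J -> set R) : set (J -> R) := [set u | forall j, B j (u j)].
(** A pi-system that serves as generator of the product sigma-algebra on [J -> R]. *)
Definition boxes : set (set (J -> R)) :=
  [set X | exists2 B, (forall j, measurable (B j)) & X = box B].

Lemma boxes_setI : setI_closed boxes.
Proof.
move=> _ _ [B mB ->] [B' mB' ->]; exists (fun j => B j `&` B' j).
  by move=> j; exact: measurableI.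
apply/seteqP; split=> u; first by move=> [h h'] j; split.
by move=> h; split=> j; have [] := h j.
Qed.

Lemma boxesT : boxes setT.
Proof. by exists (fun=> setT) => //; apply/seteqP; split. Qed.

Lemma measurable_coord (j : J) :
  measurable_fun setT (fun u : g_sigma_algebraType boxes => u j).
Proof.
move=> _ A mA; rewrite setTI; apply: sub_sigma_algebra.
exists (fun i => if i == j then A else setT).
  by move=> i; case: ifP.
apply/seteqP; split=> u /= h; last by have := h j; rewrite eqxx.
by move=> i; case: eqP => [->|].
Qed.

Variables (d : measure_display) (T : measurableType d) (P : probability T R).

(** Checking the generating boxes suffices, and their preimages are finite intersections because [J]
    is finite. *)
Lemma measurable_family (X : J -> T -> R) : (forall j, measurable_fun setT (X j)) ->
  measurable_fun setT (fun w => X^~ w : g_sigma_algebraType boxes).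
Proof.
move=> mX; apply: (@measurability _ _ T (g_sigma_algebraType boxes) setT _ boxes).
  by [].
move=> _ [_ [B mB ->] <-].
rewrite setTI [X in measurable X](_ : _ = \bigcap_(j in setT) (X j @^-1` B j)).
  apply: fin_bigcap_measurable => [|j _]; first exact: finite_finset.
  by rewrite -[X in measurable X]setTI; exact: mX.
by apply/seteqP; split=> w h; [move=> j _; exact: h|move=> j; exact: h].
Qed.

(** Restricting [P] to [D] and to [D'] and pushing forward gives two finite measures that agree on a
    pi-system. The events [D] and [D'] leave room for conditions on the initial profile. *)
Lemma joint_law_unique (X Y : J -> T -> R) (D D' : set T) :
  (forall j, measurable_fun setT (X j)) -> (forall j, measurable_fun setT (Y j)) ->
  measurable D -> measurable D' ->
  (forall B : J -> set R, (forall j, measurable (B j)) ->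
    P ([set w | box B (X^~ w)] `&` D) = P ([set w | box B (Y^~ w)] `&` D')) ->
  forall E : set (J -> R), boxes.-sigma.-measurable E ->
    P ([set w | E (X^~ w)] `&` D) = P ([set w | E (Y^~ w)] `&` D').
Proof.
move=> mX mY mD mD' eqB E mE.
have mX' := measurable_family mX.
have mY' := measurable_family mY.
have [p1 p1E] := pushforward_measure_ex (mrestr P mD) mX'.
have [p2 p2E] := pushforward_measure_ex (mrestr P mD') mY'.
rewrite -[LHS](p1E E) -[RHS](p2E E).
apply: (@measure_unique _ R (g_sigma_algebraType boxes) boxes (fun=> setT)) => //.
- exact: boxes_setI.
- by move=> i; exact: boxesT.
- by apply: bigcup_const; exists 0%N.
- by move=> _ [B mB ->]; rewrite p1E p2E; exact: eqB.
- move=> _; rewrite p1E /= /mrestr preimage_setT setTI.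
  by apply: (le_lt_trans (probability_le1 _ _)) => //; rewrite ltry.
Qed.

End JointLaw.

(** * Ties between independent atomless variables *)

Section Ties.
Variables (R : realType) (mu : probability R R).
Hypothesis atomless : forall x : R, mu [set x] = 0%E.

(** Every section of the diagonal is a singleton, hence null. *)
Lemma diagonal_null : (mu \x mu)%E [set z : R * R | z.1 = z.2] = 0%E.
Proof.
rewrite /product_measure1 /=; apply: integral0_eq => x _ /=.
rewrite [X in mu X](_ : _ = [set x]) //.
by apply/seteqP; split=> y; rewrite /xsection /= inE /= => ->.
Qed.

Lemma measurable_diagonal : measurable [set z : R * R | z.1 = z.2].
Proof.
have := @measurable_realfun.measurable_fun_eqr _ _ R setT fst snd
  measurable_fst measurable_snd.
move=> /(_ measurableT [set true]) /(_ _); rewrite setTI => h.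
rewrite [X in measurable X](_ : _ = (fun x : R * R => x.1 == x.2) @^-1` [set true]).
  exact: h.
by apply/seteqP; split=> z /= /eqP.
Qed.

(** Independence identifies the law of the pair with the product measure, for which the diagonal is
    null. *)
Lemma tie_null (d : measure_display) (T : measurableType d) (P : probability T R)
    (X Y : T -> R) : measurable_fun setT X -> measurable_fun setT Y ->
  (forall A B, measurable A -> measurable B ->
    P (X @^-1` A `&` Y @^-1` B) = (mu A * mu B)%E) ->
  measurable [set w | X w = Y w] /\ P [set w | X w = Y w] = 0%E.
Proof.
move=> mX mY ind.
have mXY : measurable_fun setT (fun w => (X w, Y w)) by exact: measurable_fun_pair.
split.
  have := mXY measurableT _ measurable_diagonal; rewrite setTI.
  by [].
have [m' m'E] := pushforward_measure_ex P mXY.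
rewrite -[LHS](m'E [set z | z.1 = z.2]) -(@product_measure_unique _ _ _ _ _ mu mu).
- exact: diagonal_null.
- by move=> A B mA mB; rewrite m'E; exact: ind.
- exact: measurable_diagonal.
Qed.
End Ties.

(** * Strict best responses and their symmetries *)

Section StrictBest.
Variables (R : realType) (m1 m2 : nat).
Local Notation J := (pindex m1 m2).
Implicit Types (u : J -> R) (h : brpair m1 m2).

(** Written on payoff indices, so that both players are handled by one map that can be conjugated by
    permutations of the indices. *)
Definition best h (j : J) : J :=
  if j.1 == ord0 then (j.1, (h.1 j.2.2, j.2.2)) else (j.1, (j.2.1, h.2 j.2.1)).

Definition strict_best h : set (J -> R) :=
  [set u | forall j, j != best h j -> u j < u (best h j)].

Lemma ord2P (i : 'I_2) : i = ord0 \/ i = ord_max.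
Proof. by case: i => [[|[|//]] ?]; [left|right]; exact: val_inj. Qed.

Lemma strict_best_BR1 h u x y : strict_best h u -> BR1 u x y = h.1 y.
Proof.
move=> hu; rewrite /BR1; case: arg_maxP => // i _ imax.
apply/eqP; apply: contraT => ne.
have := hu (ord0, (i, y)); rewrite /best /= ltNge.
have -> : u (ord0, (h.1 y, y)) <= u (ord0, (i, y)) by exact: imax.
by apply; apply: contraNneq ne => -[{1}->].
Qed.

Lemma strict_best_BR2 h u y x : strict_best h u -> BR2 u y x = h.2 x.
Proof.
move=> hu; rewrite /BR2; case: arg_maxP => // i _ imax.
apply/eqP; apply: contraT => ne.
have := hu (ord_max, (x, i)); rewrite /best /= ltNge.
have -> : u (ord_max, (x, h.2 x)) <= u (ord_max, (x, i)) by exact: imax.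
by apply; apply: contraNneq ne => -[{1}->].
Qed.

Lemma strict_best_inj h h' u : strict_best h u -> strict_best h' u -> h = h'.
Proof.
move=> hu hu'; case: h h' hu hu' => [f g] [f' g'] hu hu'; congr pair; apply/ffunP.
  by move=> y; rewrite -(strict_best_BR1 (f y) y hu) (strict_best_BR1 _ _ hu').
by move=> x; rewrite -(strict_best_BR2 (g x) x hu) (strict_best_BR2 _ _ hu').
Qed.

(** The profile [a] supplies the default actions of the argmaxes; injectivity makes each maximum
    strict. *)
Lemma strict_best_ex (a : profile m1 m2) u : injective u -> exists h, strict_best h u.
Proof.
move=> uI; exists ([ffun y => BR1 u a.1 y], [ffun x => BR2 u a.2 x]) => j jb.
rewrite lt_neqAle (inj_eq uI) jb /=.
case: j {jb} => [i [x y]]; rewrite /best /=.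
have [->|->] := ord2P i; rewrite /= ffunE.
  by rewrite /BR1; case: arg_maxP => // x' _ /(_ x); apply.
by rewrite /BR2; case: arg_maxP => // y' _ /(_ y); apply.
Qed.

(** Exchanges, inside each row, the entries that [h] and [h'] declare best. As a permutation of
    i.i.d. payoffs it preserves their law, while it exchanges the events for [h] and [h']. *)
Definition swap_best h h' (j : J) : J :=
  if j.1 == ord0 then (j.1, (tperm (h.1 j.2.2) (h'.1 j.2.2) j.2.1, j.2.2))
  else (j.1, (j.2.1, tperm (h.2 j.2.1) (h'.2 j.2.1) j.2.2)).

Lemma swap_bestK h h' : involutive (swap_best h h').
Proof.
by case=> i [x y]; rewrite /swap_best /=; case: (ord2P i) => -> /=; rewrite tpermK.
Qed.

Lemma best_swap h h' j : best h' (swap_best h h' j) = swap_best h h' (best h j).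
Proof.
case: j => i [x y]; rewrite /swap_best /best /=.
by case: (ord2P i) => -> /=; rewrite tpermL.
Qed.

Lemma strict_best_swap h h' u :
  strict_best h (u \o swap_best h h') <-> strict_best h' u.
Proof.
have sI := inv_inj (swap_bestK h h').
split=> hu j jb; last by rewrite /= -best_swap; apply: hu; rewrite best_swap (inj_eq sI).
have := hu (swap_best h h' j); rewrite /= swap_bestK -best_swap swap_bestK; apply.
by rewrite -(inj_eq sI) swap_bestK -best_swap swap_bestK.
Qed.

Lemma measurable_strict_best h : (@boxes R J).-sigma.-measurable (strict_best h).
Proof.
rewrite [X in measurable X](_ : _ =
  \bigcap_(j in [set j | j != best h j]) [set u : J -> R | u j < u (best h j)]).
  apply: fin_bigcap_measurable => [|j _]; first exact: finite_finset.
  have := @measurable_realfun.measurable_fun_ltr _ _ R setT _ _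
    (measurable_coord (j : J)) (measurable_coord (best h j)).
  by move=> /(_ measurableT [set true]) /(_ _); rewrite setTI; apply.
by apply/seteqP; split.
Qed.

(** [arg_max] selects by comparisons alone, so this holds even when there are ties. *)
Lemma BR_pattern u u' : (forall i j, (u i <= u j) = (u' i <= u' j)) ->
  BR1 u = BR1 u' /\ BR2 u = BR2 u'.
Proof.
move=> uu'; split; apply/funext => z; apply/funext => z'.
  rewrite /BR1 /Order.arg_max /extremum; congr odflt; apply: eq_pick => i /=.
  by apply: eq_forallb => j /=; rewrite uu'.
rewrite /BR2 /Order.arg_max /extremum; congr odflt; apply: eq_pick => i /=.
by apply: eq_forallb => j /=; rewrite uu'.
Qed.

Lemma converges_at_pattern u u' a k t : (forall i j, (u i <= u j) = (u' i <= u' j)) ->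
  converges_at u a k t = converges_at u' a k t.
Proof.
move=> /BR_pattern[e1 e2].
have e n : cw_dyn u a n = cw_dyn u' a n.
  by elim: n => //= n ->; rewrite /cw_step e1 e2.
rewrite /converges_at /cycle_cond.
have -> : cw_dyn u a = cw_dyn u' a by apply/funext.
by [].
Qed.
End StrictBest.

(** * The random game: equiprobable cells and the convergence event *)

Section FiniteAdditivity.
Variables (R : realType) (d : measure_display) (T : measurableType d).

Lemma probability_finType_bigcup (P : probability T R) (I : finType) (Q : pred I)
    (F : I -> set T) : (forall i, measurable (F i)) -> trivIset setT F ->
  P (\bigcup_(i in [set i | Q i]) F i) = (\sum_(i | Q i) P (F i))%E.
Proof.
move=> mF tF; rewrite measure_fin_bigcup //; first last.
- exact: sub_trivIset tF.
- exact: finite_finset.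
have -> : [set i | Q i] = [set` enum Q].
  by apply/seteqP; split=> i /=; rewrite mem_enum.
by rewrite -fsbig_seq ?enum_uniq // big_enum.
Qed.
End FiniteAdditivity.

Section RandomGame.
Variables (R : realType) (d : measure_display) (T : measurableType d)
  (P : probability T R) (m1 m2 : nat)
  (U : pindex m1 m2 -> T -> R) (A0 : T -> profile m1 m2) (mu : probability R R).
Local Notation J := (pindex m1 m2).
Hypotheses (m1_gt0 : (0 < m1)%N) (m2_gt0 : (0 < m2)%N).
Hypothesis atomless : forall x : R, mu [set x] = 0%E.
Hypothesis mU : forall j, measurable_fun setT (U j).
Hypothesis mA0 : forall a, measurable (A0 @^-1` [set a]).
Hypothesis indep : forall (S : {set profile m1 m2}) (B : J -> set R),
     (forall j, measurable (B j)) ->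
     P ([set w | A0 w \in S] `&` \bigcap_(j in [set: J]) (U j @^-1` B j))
     = ((#|S|%:R / (m1 * m2)%:R : R)%:E * \prod_(j : J) mu (B j))%E.

(** These disjoint events fix all the data that drive the dynamic, and they cover everything outside
    [ties]. *)
Definition cell (ah : profile m1 m2 * brpair m1 m2) : set T :=
  [set w | strict_best ah.2 (U^~ w)] `&` A0 @^-1` [set ah.1].

Lemma measurable_cell ah : measurable (cell ah).
Proof.
apply: measurableI => //.
have := measurable_family mU measurableT (measurable_strict_best ah.2).
by rewrite setTI.
Qed.

Lemma trivIset_cell : trivIset setT cell.
Proof.
move=> [a h] [a' h'] _ _ [w [[/= hw aw] [/= hw' aw']]].
by rewrite -aw -aw' (strict_best_inj hw hw').
Qed.

(** Swapping payoffs inside rows carries the event for [h] to the one for [h'] without changing the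
    joint law, and all initial profiles have the same weight. *)
Lemma cell_eqprob ah ah' : P (cell ah) = P (cell ah').
Proof.
case: ah ah' => [a h] [a' h']; rewrite /cell /=.
have sI := inv_inj (swap_bestK h h').
rewrite (_ : [set w | strict_best h' (U^~ w)] =
    [set w | strict_best h ((fun j => U (swap_best h h' j))^~ w)]); last first.
  by apply/seteqP; split=> w /=; rewrite -(strict_best_swap h h').
apply: joint_law_unique => //; last exact: measurable_strict_best.
move=> B mB.
have boxE (V : J -> T -> R) b : [set w | box B (V^~ w)] `&` A0 @^-1` [set b] =
    [set w | A0 w \in [set b]%SET] `&` \bigcap_(j in [set: J]) (V j @^-1` B j).
  rewrite setIC; congr (_ `&` _).
    by apply/seteqP; split=> w /=; rewrite inE => /eqP.
  by apply/seteqP; split=> w hw; [move=> j _|move=> j]; exact: hw.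
rewrite !boxE indep //.
(* A box for the permuted payoffs is the permuted box for the original ones; its product of measures
   has the same factors. *)
rewrite [X in P (_ `&` X)](_ : _ =
    \bigcap_(j in [set: J]) (U j @^-1` B (swap_best h h' j))).
  rewrite indep // !cards1; congr (_ * _)%E.
  by rewrite [LHS](reindex_inj sI).
apply/seteqP; split=> w hw j _ /=.
  by have := hw (swap_best h h' j) I; rewrite /= swap_bestK.
by have := hw (swap_best h h' j) I; rewrite /= swap_bestK.
Qed.

Lemma indep_pair i j : i != j -> forall A B, measurable A -> measurable B ->
    P (U i @^-1` A `&` U j @^-1` B) = (mu A * mu B)%E.
Proof.
move=> ij A B mA mB.
(* All other coordinates, and the initial profile, are left unconstrained and contribute a factor
   one. *)
pose C l := if l == i then A else if l == j then B else setT.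
have := @indep [set: profile m1 m2]%SET C.
rewrite (_ : _ `&` _ = U i @^-1` A `&` U j @^-1` B); last first.
  apply/seteqP; split=> w /=.
    move=> [_ hw]; have := hw i I; have := hw j I.
    by rewrite /= /C eqxx [j == i]eq_sym (negbTE ij) eqxx.
  move=> [hA hB]; split; first by rewrite inE.
  by move=> l _ /=; rewrite /C; case: eqP => [->//|_]; case: eqP => [->|].
move=> ->; last by move=> l; rewrite /C; do 2?case: ifP.
rewrite cardsT card_prod !card_ord divff ?mul1e; last first.
  by rewrite pnatr_eq0 muln_eq0 negb_or -!lt0n m1_gt0.
rewrite (bigD1 i) //= (bigD1 j) 1?eq_sym //= big1 ?mule1.
  by rewrite /C eqxx eq_sym (negbTE ij) eqxx.
by move=> l /andP[/negbTE li /negbTE lj]; rewrite /C li lj probability_setT.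
Qed.

(** Ties across different rows are included, so that off this set the payoff function is injective,
    as [strict_best_ex] requires. *)
Definition ties : set T :=
  \bigcup_(ij in [set ij : J * J | ij.1 != ij.2]) [set w | U ij.1 w = U ij.2 w].

Lemma ties_null : measurable ties /\ P ties = 0%E.
Proof.
have tN (ij : J * J) : ij.1 != ij.2 ->
    measurable [set w | U ij.1 w = U ij.2 w] /\
    P [set w | U ij.1 w = U ij.2 w] = 0%E.
  by move=> nij; apply: (tie_null atomless) => //; exact: indep_pair.
have mt : measurable ties.
  by apply: fin_bigcup_measurable => [|ij /tN[]//]; exact: finite_finset.
split=> //; apply/(negligibleP _ mt).
rewrite /ties -bigsetU_fset_set; last exact: finite_finset.
rewrite big_seq; elim/big_ind : _ => [||ij ijD]; first exact: negligible_set0.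
- exact: negligibleU.
- move: ijD; rewrite in_fset_set; last exact: finite_finset.
  by rewrite inE => /tN[m0 P0]; exact/negligibleP.
Qed.

Lemma cover_cell : ~` ties `<=` \bigcup_ah cell ah.
Proof.
move=> w nt; have uI : injective (U^~ w).
  move=> i j e; apply/eqP; apply: contra_notT nt => ij; by exists (i, j).
have [h hw] := strict_best_ex (A0 w) uI.
by exists (A0 w, h).
Qed.

(* The [cell]s miss payoffs with ties, so they do not give measurability of the
   convergence event; its dependence on the finite order pattern of the payoffs does. *)
Lemma measurable_pattern (Q : (J -> R) -> profile m1 m2 -> Prop) :
  (forall u u' a, (forall i j, (u i <= u j) = (u' i <= u' j)) -> Q u a = Q u' a) ->
  measurable [set w | Q (U^~ w) (A0 w)].
Proof.
move=> Qp.
pose pat w : {ffun J * J -> bool} := [ffun ij => U ij.1 w <= U ij.2 w].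
rewrite [X in measurable X](_ : _ =
  \bigcup_(pa in [set pa | exists2 w, Q (U^~ w) (A0 w) & (pat w, A0 w) = pa])
    ([set w | pat w = pa.1] `&` A0 @^-1` [set pa.2])).
  apply: fin_bigcup_measurable => [|pa _]; first exact: finite_finset.
  apply: measurableI => //.
  rewrite [X in measurable X](_ : _ = \bigcap_(ij in setT)
      (fun w => U ij.1 w <= U ij.2 w) @^-1` [set pa.1 ij]).
    apply: fin_bigcap_measurable => [|ij _]; first exact: finite_finset.
    have := @measurable_realfun.measurable_fun_ler _ _ R setT _ _ (mU ij.1) (mU ij.2).
    by move=> /(_ measurableT [set pa.1 ij]) /(_ _); rewrite setTI; apply.
  apply/seteqP; split=> w /=; first by move=> <- ij _; rewrite ffunE.
  by move=> hw; apply/ffunP => ij; rewrite ffunE; exact: hw.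
apply/seteqP; split=> w /=; first by move=> Qw; exists (pat w, A0 w) => //; exists w.
move=> [_ [w' Qw' <-] [/= e ->]]; rewrite (Qp _ (U^~ w')) // => i j.
by have := congr1 (fun p : {ffun J * J -> bool} => p (i, j)) e; rewrite !ffunE.
Qed.

(** The cells are disjoint, equiprobable and of total probability one, since what they miss lies in
    the null set [ties]. *)
Lemma cell_prob ah : P (cell ah) = ((#|{: profile m1 m2 * brpair m1 m2}|%:R)^-1 : R)%:E.
Proof.
have [mt Pt] := ties_null.
have mU' : measurable (\bigcup_ah cell ah).
  apply: fin_bigcup_measurable => [|? _]; [exact: finite_finset|exact: measurable_cell].
have P1 : P (\bigcup_ah cell ah) = 1%E.
  apply/eqP; rewrite eq_le probability_le1 //=.
  have <- : P (~` ties) = 1%E by rewrite probability_setC // Pt sube0.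
  by apply: le_measure; rewrite ?inE //; [exact: measurableC|exact: cover_cell].
have fP : P (cell ah) \is a fin_num by exact: fin_num_measure (measurable_cell ah).
have := probability_finType_bigcup P xpredT measurable_cell trivIset_cell.
rewrite (_ : [set i | xpredT i] = setT) ?P1; last by apply/seteqP; split.
rewrite (eq_bigr (fun=> (fine (P (cell ah)))%:E)); last first.
  by move=> ah' _; rewrite fineK //; exact: cell_eqprob.
rewrite sumEFin sumr_const => -[e]; rewrite -(fineK fP); congr EFin.
have n0 : #|{: profile m1 m2 * brpair m1 m2}|%:R != 0 :> R.
  by rewrite pnatr_eq0 -lt0n; apply/card_gt0P; exists ah.
by apply: (mulIf n0); rewrite mulVf // mulr_natr -e.
Qed.

Lemma converges_prob k t : (1 <= k)%N -> (1 <= t)%N ->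
  P [set w | converges_at (U^~ w) (A0 w) k t] =
  ((m_sc m1 m2 (t + 2 * k - 1))%:R^-1 *
     \prod_(1 <= i < t + 2 * k - 1) (1 - (i./2)%:R / (m_sc m1 m2 i)%:R) : R)%:E.
Proof.
move=> k1 t1; set E := [set w | _].
have [mt Pt] := ties_null.
have mE : measurable E.
  apply: (@measurable_pattern (fun u a => converges_at u a k t)) => u u' a.
  exact: converges_at_pattern.
pose Q (ah : profile m1 m2 * brpair m1 m2) := back ah.1.2 (t + 2 * k - 2) (t - 1) ah.2.
have convE ah w : cell ah w -> E w <-> Q ah.
  case: ah => a h [/= hw <-]; apply: converges_at_back => // *.
    exact: strict_best_BR1.
  exact: strict_best_BR2.
have mC : measurable (\bigcup_(ah in [set ah | Q ah]) cell ah).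
  apply: fin_bigcup_measurable => [|? _]; [exact: finite_finset|exact: measurable_cell].
have -> : P E = P (\bigcup_(ah in [set ah | Q ah]) cell ah).
  apply/eqP; rewrite eq_le; apply/andP; split; last first.
    by apply: le_measure; rewrite ?inE // => w [ah Qah cw]; exact/(convE ah).
  (* The event is contained in the union of its cells and [ties], and the latter adds zero. *)
  rewrite -[leRHS]adde0 -Pt; apply: (le_trans _ (measureU2 _ mC mt)).
  apply: le_measure; rewrite ?inE //; first exact: measurableU.
  move=> w Ew; have [tw|nt] := pselect (ties w); [by right|left].
  have [ah _ cw] := cover_cell nt; exists ah => //=; exact/(convE ah w).
rewrite (probability_finType_bigcup P Q measurable_cell trivIset_cell).
rewrite (eq_bigr (fun=> ((#|{: profile m1 m2 * brpair m1 m2}|%:R)^-1 : R)%:E)); last first.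
  by move=> *; exact: cell_prob.
rewrite sumEFin; congr EFin.
set c := (#|_|%:R)^-1; set r := RHS.
(* Summing over the response maps first: their contribution is the same for every initial
   profile. *)
rewrite -(pair_big_dep xpredT (fun a h => Q (a, h)) (fun _ _ => c)) /=.
have br a : \sum_(h | Q (a, h)) c = c * #|{: brpair m1 m2}|%:R * r.
  rewrite sumr_const -[LHS]mulr_natr -[RHS]mulrA; congr (_ * _).
  rewrite /r; have -> : (t + 2 * k - 1)%N = (t + 2 * k - 2).+1 by lia.
  (* The gap between the indices [t + 2 * k - 2] and [t - 1] is [2 * k - 1], which is odd. *)
  rewrite [LHS](@card_back_ratio R m1 m2 a.2) ?card_fresh //; try lia.
  by rewrite [_^-1 * _]mulrC mulrA.
rewrite (eq_bigr _ (fun a _ => br a)) sumr_const.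
rewrite -[LHS]mulr_natl [LHS]mulrA -[RHS]mul1r; congr (_ * _).
rewrite [c * _]mulrC mulrA -natrM /c.
have <- : #|{: profile m1 m2 * brpair m1 m2}| =
    (#|{: profile m1 m2}| * #|{: brpair m1 m2}|)%N.
  exact: card_prod.
apply: divff; rewrite pnatr_eq0 -lt0n; apply/card_gt0P.
pose x0 := Ordinal m1_gt0; pose y0 := Ordinal m2_gt0.
by exists ((x0, y0), ([ffun=> x0], [ffun=> y0])).
Qed.
End RandomGame.

Theorem theorem3 (R : realType) (d : measure_display) (T : measurableType d)
  (P : probability T R) (m1 m2 : nat)
  (U : pindex m1 m2 -> T -> R) (A0 : T -> profile m1 m2)
  (mu : probability R R) :
  (2 <= m1)%N -> (2 <= m2)%N ->
  (* atomless common payoff distribution *)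
  (forall x : R, mu [set x] = 0%E) ->
  (* measurability of the payoffs and of the initial profile *)
  (forall j, measurable_fun setT (U j)) ->
  (forall a, measurable (A0 @^-1` [set a])) ->
  (* payoffs i.i.d. with law mu, A^0 uniform on M, all mutually independent *)
  (forall (S : {set profile m1 m2}) (B : pindex m1 m2 -> set R),
     (forall j, measurable (B j)) ->
     P ([set w | A0 w \in S] `&` \bigcap_(j in [set: pindex m1 m2]) (U j @^-1` B j))
     = ((#|S|%:R / (m1 * m2)%:R : R)%:E * \prod_(j : pindex m1 m2) mu (B j))%E) ->
  forall k t : nat,
    (1 <= k <= minn m1 m2)%N -> (1 <= t <= 2 * (minn m1 m2 - k + 1))%N ->
    P [set w | converges_at (fun j => U j w) (A0 w) k t]
    = ((m_sc m1 m2 (t + 2 * k - 1))%:R^-1 *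
       \prod_(1 <= i < t + 2 * k - 1)
          (1 - (i./2)%:R / (m_sc m1 m2 i)%:R) : R)%:E.
Proof.
move=> m1_ge2 m2_ge2 atomless mU mA0 indep k t /andP[k1 _] /andP[t1 _].
by apply: (converges_prob _ _ atomless mU mA0 indep k1 t1); exact: ltnW.
Qed.
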